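(* Let $(\Omega,\Sigma,\mu)$ be an arbitrary measure space and set $X=L_1(\mu;\mathbb{R})$. Let $(C_i)_{i=1}^\infty$ be non-empty wHD2 subsets of the closed unit ball $B_X$, and let $\lambda_i\geq 0$ with $\sum_{i=1}^\infty\lambda_i=1$. Then $\sum_{i=1}^\infty \lambda_i C_i$ is wHD2. In particular, it has diameter $2$.
   Context: For a non-empty bounded subset $C$ of a Banach space, $\operatorname{diam}(C)=\sup\{\|x-y\|:x,y\in C\}$. For a real Banach space $Y$ with closed unit ball $B_Y$, a non-empty set $C\subset B_Y$ is called wHD2 (weakly hereditarily diameter $2$) if $\operatorname{diam}(C\cap W)\ge 2$ for every weakly open set $W\subset Y$ with $C\cap W\neq\emptyset$. For subsets $C_i\subset B_X$ and $\lambda_i\ge 0$ with $\sum_i\lambda_i=1$, $\sum_i\lambda_iC_i=\{\sum_i\lambda_ic_i : c_i\in C_i\}$, where the series are norm convergent (absolutely, since $C_i\subset B_X$). *)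

(* Defs.v *)
From HB Require Import structures.
From mathcomp Require Import all_boot all_order all_algebra.
From mathcomp Require Import all_classical all_reals all_analysis.
From mathcomp Require Import measurable_realfun lra.

Set Implicit Arguments.
Unset Strict Implicit.
Unset Printing Implicit Defensive.

Import Order.TTheory GRing.Theory Num.Theory.
Import numFieldNormedType.Exports.

Local Open Scope classical_set_scope.
Local Open Scope ring_scope.

Section L1.
Context d (T : measurableType d) (R : realType).
Variable mu : {measure set T -> \bar R}.

Local Notation L1fun := (LfunType mu (@lexx _ _ 1%E)).

(* The library's quotient type of a.e. classes carries no algebraic or metric
   structure; it is made into a Banach space below. *)
Definition L1 : Type := LspaceType1 mu.

HB.instance Definition _ := gen_eqMixin L1.
HB.instance Definition _ := gen_choiceMixin L1.

Lemma ae_eq_Lnorm1 (f g : T -> R) :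
  measurable_fun setT f -> measurable_fun setT g ->
  f = g %[ae mu] -> ('N[mu]_1[EFin \o f] = 'N[mu]_1[EFin \o g])%E.
Proof.
move=> mf mg fg; rewrite !Lnorm1; apply: ae_eq_integral => //.
- by apply: measurableT_comp => //; exact/measurable_EFinP.
- by apply: measurableT_comp => //; exact/measurable_EFinP.
- by apply: filterS fg => x h _ /=; rewrite h.
Qed.

Section L1_class.
Variable f : L1fun.

(* [R] and [measurableTypeR R] have the same measurable sets, but not
   convertible measurable structures *)
Let mf : (f : T -> measurableTypeR R) \in mfun.
Proof. by rewrite inE => mT Y mY; exact: (measurable_funPT f). Qed.

Let c : {mfun_ mu, T >-> measurableTypeR R} :=
  (\pi_(@aeEqMfun _ _ R T (measurableTypeR R) mu) (mfun_Sub mf))%qT.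

Let repr_pi : (c : T -> R) = f %[ae mu].
Proof. by have /eqmodP/asboolP := reprK c. Qed.

Let finite_repr_pi : finite_norm mu 1 c.
Proof.
have mc : measurable_fun setT (c : T -> R).
  by move=> mT Y mY; exact: (measurable_funPT (repr c)).
have := @ae_eq_Lnorm1 _ f mc (measurable_funPT f) repr_pi.
by rewrite /finite_norm => ->; exact: Lfunction_finite.
Qed.

Definition L1_class : L1 :=
  LebesgueSpace.Pack
    (LebesgueSpace.Class (isFinLebesgue.phant_Build (lexx 1%E) finite_repr_pi)).

Lemma L1_class_ae : (L1_class : T -> R) = f %[ae mu].
Proof. exact: repr_pi. Qed.
End L1_class.


Let Lfun_L1 (x : L1) : (x : T -> R) \in Lfun mu 1.
Proof.
rewrite inE; apply/andP; split; rewrite inE/=.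
  by move=> mT Y mY;
    exact: (measurable_funPT (repr (x : {mfun_ mu, T >-> measurableTypeR R}))).
exact: Lebesgue_finite.
Qed.

Definition L1_repr (x : L1) : L1fun := Lfun_Sub (lexx 1%E) (Lfun_L1 x).

Lemma L1_eqP (x y : L1) : x = y <-> (x : T -> R) = y %[ae mu].
Proof.
split=> [->|]; first exact: ae_eq_refl.
case: x y => [x [[xP]]] [y [[yP]]] /= xy.
have /eqP exy : x == y.
  by rewrite -(reprK x) -(reprK y); apply/eqP/eqmodP/asboolP.
by move: xP yP {xy}; rewrite exy => xP yP; rewrite (Prop_irrelevance xP yP).
Qed.

Definition L1_zero : L1 := L1_class 0.
Definition L1_opp (x : L1) : L1 := L1_class (- L1_repr x).
Definition L1_add (x y : L1) : L1 := L1_class (L1_repr x + L1_repr y).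
Definition L1_scale (a : R) (x : L1) : L1 := L1_class (a *: L1_repr x).
Definition L1_norm (x : L1) : R := fine ('N[mu]_1[EFin \o (x : T -> R)]).

Let zeroE : (L1_zero : T -> R) = cst 0 %[ae mu].
Proof. exact: L1_class_ae. Qed.

Let oppE x : (L1_opp x : T -> R) = (fun t => - x t) %[ae mu].
Proof. exact: L1_class_ae. Qed.

Let addE x y : (L1_add x y : T -> R) = (fun t => x t + y t) %[ae mu].
Proof. exact: L1_class_ae. Qed.

Let scaleE a x : (L1_scale a x : T -> R) = (fun t => a * x t) %[ae mu].
Proof. exact: L1_class_ae. Qed.

Let aeI (P Q : T -> Prop) : {ae mu, forall t, P t} ->
  {ae mu, forall t, Q t} -> {ae mu, forall t, P t /\ Q t}.
Proof. exact: filterI. Qed.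

Let addA : associative L1_add.
Proof.
move=> x y z; apply/L1_eqP.
have h1 := aeI (addE x (L1_add y z)) (addE y z).
have h2 := aeI (addE (L1_add x y) z) (addE x y).
move: h1 h2; apply: filterS2 => t [h1 h2] [h3 h4] _.
by rewrite h1// h2// h3// h4// addrA.
Qed.

Let addC : commutative L1_add.
Proof.
move=> x y; apply/L1_eqP; move: (addE x y) (addE y x).
by apply: filterS2 => t h1 h2 _; rewrite h1// h2// addrC.
Qed.

Let add0 : left_id L1_zero L1_add.
Proof.
move=> x; apply/L1_eqP; move: (addE L1_zero x) zeroE.
by apply: filterS2 => t h1 h2 _; rewrite h1// h2// add0r.
Qed.

Let addN : left_inverse L1_zero L1_opp L1_add.
Proof.
move=> x; apply/L1_eqP; move: (addE (L1_opp x) x) (oppE x) zeroE.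
by apply: filterS3 => t h1 h2 h3 _; rewrite h1// h2// h3// addNr.
Qed.

HB.instance Definition _ := GRing.isZmodule.Build L1 addA addC add0 addN.

Let scaleA a b x : L1_scale a (L1_scale b x) = L1_scale (a * b) x.
Proof.
apply/L1_eqP; move: (scaleE a (L1_scale b x)) (scaleE b x) (scaleE (a * b) x).
by apply: filterS3 => t h1 h2 h3 _; rewrite h1// h2// h3// mulrA.
Qed.

Let scale1 : left_id 1 L1_scale.
Proof.
move=> x; apply/L1_eqP; move: (scaleE 1 x).
by apply: filterS => t h1 _; rewrite h1// mul1r.
Qed.

Let scaleDr : right_distributive L1_scale +%R.
Proof.
move=> a x y; apply/L1_eqP.
have h1 := scaleE a (x + y).
have h2 := addE x y.
have h3 := addE (L1_scale a x) (L1_scale a y).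
have h45 := aeI (scaleE a x) (scaleE a y).
move: (aeI h1 h2) h3 h45.
apply: filterS3 => t [{}h1 {}h2] h3' [h4 h5] _.
by rewrite h1// [X in a * X]h2// h3'// h4// h5// mulrDr.
Qed.

Let scaleDl x : {morph L1_scale^~ x : a b / a + b}.
Proof.
move=> a b; apply/L1_eqP.
have h1 := addE (L1_scale a x) (L1_scale b x).
move: (aeI h1 (scaleE (a + b) x)) (aeI (scaleE a x) (scaleE b x)).
apply: filterS2 => t [{}h1 h2] [h3 h4] _.
by rewrite h1// h2// h3// h4// mulrDl.
Qed.

HB.instance Definition _ :=
  GRing.Zmodule_isLmodule.Build R L1 scaleA scale1 scaleDr scaleDl.

Let L1_meas (x : L1) : measurable_fun [set: T] (x : T -> R).
Proof. exact: (measurable_funPT (L1_repr x)). Qed.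

Let normE (f : L1fun) (x : L1) : (x : T -> R) = f %[ae mu] ->
  (L1_norm x)%:E = 'N[mu]_1[EFin \o f]%E.
Proof. by move=> xf; rewrite -finite_norm_fine /L1_norm (ae_eq_Lnorm1 _ _ xf). Qed.

Let ler_normD x y : L1_norm (x + y) <= L1_norm x + L1_norm y.
Proof.
rewrite -lee_fin EFinD (normE (L1_class_ae _)).
rewrite (@normE (L1_repr x) x) ?(@normE (L1_repr y) y); [|exact: ae_eq_refl..].
exact: eminkowski.
Qed.

Let normZ a x : L1_norm (a *: x) = `|a| * L1_norm x.
Proof.
apply/EFin_inj; rewrite EFinM (normE (L1_class_ae _)).
by rewrite (@normE (L1_repr x) x) ?LnormZ//; exact: ae_eq_refl.
Qed.

Let norm0_eq0 x : L1_norm x = 0 -> x = 0.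
Proof.
move=> /(@fine_Lnormr_eq0 _ _ _ mu _ _ (L1_repr x)) x0.
apply/L1_eqP; move: x0 zeroE.
by apply: filterS2 => t h1 h2 _; rewrite h2//; exact: h1.
Qed.

HB.instance Definition _ :=
  Lmodule_isNormed.Build R L1 ler_normD normZ norm0_eq0.

Lemma L1_norm_integral (x : L1) : `|x|%:E = (\int[mu]_t `|x t|%:E)%E.
Proof.
rewrite [LHS](@normE (L1_repr x) x) ?Lnorm1//; exact: ae_eq_refl.
Qed.

Let dist_meas (x : L1) (g : T -> R) : measurable_fun [set: T] g ->
  measurable_fun [set: T] (fun t => `|x t - g t|%:E).
Proof.
move=> mg; apply/measurable_EFinP; apply: measurableT_comp => //.
by apply: measurable_funB.
Qed.

Lemma L1_dist_integral (x y : L1) (g : T -> R) : measurable_fun [set: T] g ->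
  (y : T -> R) = g %[ae mu] ->
  `|x - y|%:E = (\int[mu]_t `|x t - g t|%:E)%E.
Proof.
move=> mg yg; rewrite L1_norm_integral; apply: ae_eq_integral => //.
- by apply/measurable_EFinP; apply: measurableT_comp.
- exact: dist_meas.
have h1 : (x - y : T -> R) = (fun t => x t + (- y : L1) t) %[ae mu].
  exact: L1_class_ae.
have h2 : ((- y : L1) : T -> R) = (fun t => - y t) %[ae mu].
  exact: L1_class_ae.
move: h1 h2 yg; apply: filterS3 => t h1 h2 h3 _.
by rewrite h1// h2// h3.
Qed.

Let geo_lt (n m : nat) (a : nat -> R) : (forall k, a k <= 2^-1 ^+ k) ->
  \sum_(n <= k < m) a k <= 2 * 2^-1 ^+ n.
Proof.
move=> ha; apply: (le_trans (ler_sum_nat (fun i _ => ha i))).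
have [nm|mn] := leqP n m; last first.
  by rewrite big_geq ?(ltnW mn)// mulr_ge0// exprn_ge0// invr_ge0.
suff -> : \sum_(n <= k < m) (2^-1 : R) ^+ k = 2 * (2^-1 ^+ n - 2^-1 ^+ m).
  by rewrite mulrBr gerBl mulr_ge0// exprn_ge0// invr_ge0.
rewrite (eq_bigr (fun k => - 2 * (2^-1 : R) ^+ k.+1 - - 2 * 2^-1 ^+ k)).
  by rewrite telescope_sumr// !mulNr opprK addrC -mulrBr.
by move=> k _; rewrite exprS !mulNr mulrA divff// mul1r opprK -{3}(mul1r (2^-1^+k)) mulrDl !mul1r addrA addNr add0r.
Qed.

Section fast.
Variable x_ : nat -> L1.
Hypothesis hx : forall n, `|x_ n.+1 - x_ n| <= 2^-1 ^+ n.

Let u n t := x_ n.+1 t - x_ n t.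

Let fast_dist n m : (n <= m)%N -> `|x_ n - x_ m| <= 2 * 2^-1 ^+ n.
Proof.
move=> nm; rewrite distrC -telescope_sumr//.
exact: (le_trans (ler_norm_sum _ _ _)) (geo_lt _ _ hx).
Qed.

Let dE n m : `|x_ n - x_ m|%:E = (\int[mu]_t `|x_ n t - x_ m t|%:E)%E.
Proof. by apply: L1_dist_integral => //; exact: ae_eq_refl. Qed.

Let mu_u n : measurable_fun [set: T] (fun t => `|u n t|%:E).
Proof. exact: dist_meas. Qed.

Let fast_ae : {ae mu, forall t, cvgn (fun n => x_ n t)}.
Proof.
pose H t := (\sum_(0 <= n <oo) `|u n t|%:E)%E.
have H0 t : (0 <= H t)%E.
  apply: nneseries_ge0 => k _ _. by rewrite lee_fin.
have mH : measurable_fun [set: T] H.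
  by apply: ge0_emeasurable_sum => //= *; rewrite lee_fin.
have iH : (\int[mu]_t H t <= 2%:E)%E.
  rewrite integral_nneseries//.
  apply: lime_le.
    by apply: is_cvg_nneseries => *; exact: integral_ge0.
  apply: nearW => m.
  under eq_bigr => i _ do rewrite -dE.
  rewrite sumEFin lee_fin; have := @geo_lt 0 m _ hx.
  by rewrite expr0 mulr1.
have : mu.-integrable [set: T] H.
  apply/integrableP; split => //.
  under eq_integral do rewrite gee0_abs//.
  by rewrite (le_lt_trans iH)// ltry.
move/integrable_ae => /(_ measurableT); apply: filterS => t /(_ I) Hfin.
have cu : cvgn (series (u ^~ t)).
  apply: normed_cvg; apply: nondecreasing_is_cvgn.
    by apply: nondecreasing_series => k _ _; exact: normr_ge0.
  exists (fine (H t)) => _ [n _ <-] /=.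
  rewrite -lee_fin fineK// /series/= -sumEFin.
  by apply: nneseries_lim_ge => *; rewrite lee_fin.
suff -> : (fun n => x_ n t) = (fun n => x_ 0 t + series (u ^~ t) n).
  by apply: is_cvgD => //; exact: is_cvg_cst.
by apply/funext => n; rewrite /series/= /u telescope_sumr// addrC subrK.
Qed.

Let g t := fine (limn_esup (fun n => (x_ n t)%:E)).

Let mg : measurable_fun [set: T] g.
Proof.
apply: measurableT_comp => //; apply: measurable_fun_limn_esup => n.
exact/measurable_EFinP.
Qed.

Let cg : {ae mu, forall t, x_ n t @[n --> \oo] --> g t}.
Proof.
apply: filterS fast_ae => t /cvg_ex[l xl].
suff -> : g t = l by [].
have /cvg_limn_einf_sup[_] : (x_ n t)%:E @[n --> \oo] --> l%:E 
  by apply/fine_cvgP; split => //; exact: nearW.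
by rewrite /g => ->.
Qed.

Let ig n : (\int[mu]_t `|x_ n t - g t|%:E <= (2 * 2^-1 ^+ n)%:E)%E.
Proof.
pose F m t := (`|x_ n t - x_ m t|%:E)%E.
have mF m : measurable_fun [set: T] (F m) by exact: dist_meas.
have -> : (\int[mu]_t `|x_ n t - g t|%:E = \int[mu]_t limn_einf (F ^~ t))%E.
  apply: ae_eq_integral => //; first exact: dist_meas.
    rewrite (_ : (fun t => limn_einf (F ^~ t)) =
      (fun t => - limn_esup (fun m => - F m t))%E); last first.
      by apply/funext => t; rewrite limn_esupN oppeK.
    apply: measurableT_comp => //; apply: measurable_fun_limn_esup => m.
    exact: measurableT_comp.
  apply: filterS cg => t xg _.
  suff : F ^~ t @ \oo --> `|x_ n t - g t|%:E by move/cvg_limn_einf_sup => [-> _].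
  apply/fine_cvgP; split; first exact: nearW.
  by apply: cvg_norm; apply: cvgB => //; exact: cvg_cst.
apply: (le_trans (fatou _ _ _ _)) => //; first by move=> *; rewrite lee_fin.
rewrite limn_einf_lim; apply: lime_le; first exact: is_cvg_einfs.
exists n => // m /= nm; apply: (@le_trans _ _ (\int[mu]_t F m t)%E).
  by apply: ereal_inf_lbound; exists m => /=.
by rewrite -dE lee_fin; exact: fast_dist.
Qed.

Let gL : g \in Lfun mu 1.
Proof.
apply/Lfun1_integrable.
have i0 : mu.-integrable [set: T] (EFin \o x_ 0).
  by apply/Lfun1_integrable; exact: (LfunP (L1_repr (x_ 0))).
have i1 : mu.-integrable [set: T] (fun t => (x_ 0 t - g t)%:E).
  apply/integrableP; split.
    by apply/measurable_EFinP; exact: measurable_funB.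
  by apply: le_lt_trans (ltry (2 * 2^-1 ^+ 0)); exact: ig.
have := integrableB measurableT i0 i1.
apply: eq_integrable => // t _ /=.
by rewrite -EFinB opprB addrC subrK.
Qed.

Lemma fast_cvg : exists x : L1, forall n, `|x_ n - x| <= 2 * 2^-1 ^+ n.
Proof.
exists (L1_class (Lfun_Sub (lexx 1%E) gL)) => n; rewrite -lee_fin.
by rewrite (@L1_dist_integral _ _ g)//; exact: L1_class_ae.
Qed.
End fast.

Lemma L1_complete (F : set_system L1) : ProperFilter F -> cauchy F -> cvg F.
Proof.
move=> PF /cauchyP cF.
have e0 n : 0 < (4^-1 * 2^-1 ^+ n : R) by rewrite mulr_gt0// exprn_gt0.
have /choice[x_ Fx] : forall n, exists x : L1, F (ball x (4^-1 * 2^-1 ^+ n)).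
  by move=> n; exact: cF.
have hx n : `|x_ n.+1 - x_ n| <= 2^-1 ^+ n.
  have [y [y1 y2]] := filter_ex (filterI (Fx n.+1) (Fx n)).
  move: y1 y2; rewrite -ball_normE /= => y1 y2.
  rewrite (le_trans (ler_distD y _ _))// (distrC y).
  apply: (le_trans (lerD (ltW y1) (ltW y2))).
  have a0 : 0 <= (2^-1 ^+ n : R) by rewrite exprn_ge0.
  rewrite exprS; lra.
have [x xx] := fast_cvg hx.
apply/cvg_ex; exists x; apply/cvg_ballP => e e_gt0.
have [n ne] : exists n, 3 * 2^-1 ^+ n < e.
  have : geometric 3 2^-1 @ \oo --> (0 : R).
    by apply: cvg_geometric; rewrite ger0_norm; lra.
  move=> /cvgr0_norm_lt/(_ _ e_gt0)/filter_ex[n hn]; exists n.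
  exact: le_lt_trans (ler_norm _) hn.
apply: filterS (Fx n) => y; rewrite -ball_normE /= => yn.
rewrite (le_lt_trans _ ne)// (le_trans (ler_distD (x_ n) _ _))//.
rewrite distrC; apply: (le_trans (lerD (xx n) (ltW yn))).
have a0 : 0 <= (2^-1 ^+ n : R) by rewrite exprn_ge0.
lra.
Qed.

HB.instance Definition _ := Uniform_isComplete.Build L1 L1_complete.

End L1.

Section wHD2.
Context (R : realType) (Y : completeNormedModType R).

Definition weak_open (W : set Y) : Prop :=
  @open (sup_topology (fun f : {f : {linear Y -> R^o} | continuous f} =>
    Topological.on (initial_topology (sval f : Y -> R^o)))) W.

(* [sup] is 0 on empty or unbounded sets: meaningful for [C] non-empty and
   bounded *)
Definition diam (C : set Y) : R := sup [set `|x - y| | x in C & y in C].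

Definition unit_ball : set Y := [set x | `|x| <= 1].

Definition wHD2 (C : set Y) : Prop :=
  [/\ C !=set0, C `<=` unit_ball &
      forall W, weak_open W -> C `&` W !=set0 -> 2 <= diam (C `&` W)].

Definition set_series (lambda : R^nat) (C : nat -> set Y) : set Y :=
  [set x | exists2 c : Y^nat, forall i, C i (c i) &
           series (fun i => lambda i *: c i) @ \oo --> x].

End wHD2.

(* Main.v *)
(* Write defect g x = |g| + |x| - |g + x|. For real numbers it is
   2 min(|g|, |x|) if g and x have opposite signs and 0 otherwise, whence
     sum_j defect g x_j <= 2 |g| + sum_{j < k} defect x_j (- x_k),
   an inequality that passes to L1 by integration. A wHD2 set C contains, in
   each weakly open W that it meets, arbitrarily many points with pairwise
   distances close to 2 (the norm is weakly lower semicontinuous); for them the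
   last sum is small, so some x_j in C and W almost satisfies
   |g + x_j| = |g| + 1, whatever g was given in advance.
   Given a point sum_i lambda_i c_i of W, the first n terms c_i can therefore be
   replaced one after the other, by u_i in one copy and by v_i in another,
   without leaving W, each replacement adding almost lambda_i to the distance
   between the two copies. *)
From HB Require Import structures.
Require Import Defs.
From mathcomp Require Import all_boot all_order all_algebra.
From mathcomp Require Import all_classical all_reals all_analysis.
From mathcomp Require Import measurable_realfun lra ring.

Set Implicit Arguments.
Unset Strict Implicit.
Unset Printing Implicit Defensive.

Import Order.TTheory GRing.Theory Num.Theory.
Import numFieldNormedType.Exports.

Local Open Scope classical_set_scope.
Local Open Scope ring_scope.

(** * Weakly open sets: preimages under functionals and affine maps *)

Section weak_topology.
Context {R : realType} {Y : completeNormedModType R}.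
Implicit Types W V : set Y.

Local Notation weak :=
  (sup_topology (fun f : {f : {linear Y -> R^o} | continuous f} =>
    Topological.on (initial_topology (sval f : Y -> R^o)))).

Lemma weak_continuous_linear (f : {linear Y -> R^o}) :
  continuous f -> continuous (f : weak -> R^o).
Proof.
move=> cf x; apply: cvg_trans (@initial_continuous _ _ (f : Y -> R^o) x).
have xx : nbhs (x : weak) --> (x : weak) by [].
have := iffLR (cvg_sup _ _ (nbhs_filter (x : weak))) xx (exist _ f cf).
exact: cvg_app.
Qed.

Lemma weak_openT : weak_open [set: Y].
Proof. exact: openT. Qed.

Lemma weak_openI W V : weak_open W -> weak_open V -> weak_open (W `&` V).
Proof. exact: openI. Qed.

Lemma weak_open_preimage_linear (f : {linear Y -> R^o}) (U : set R^o) :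
  continuous f -> open U -> weak_open (f @^-1` U).
Proof. by move=> /weak_continuous_linear/continuousP; apply. Qed.

(** Changing one term of a series moves the sum by an affine map of that term, so staying in [W]
    becomes a weakly open condition on the new term. Continuity into a supremum topology is tested
    on each functional [f], and [f] of the affine map is affine in [f x]. *)
Lemma weak_open_preimage_affine W (a : Y) (l : R) :
  weak_open W -> weak_open [set x | W (a + l *: x)].
Proof.
pose A (x : weak) : weak := a + l *: x.
suff cA : continuous A by exact: (iffLR (continuousP A) cA).
move=> x.
apply: (iffRL (cvg_sup _ _ (fmap_filter A (nbhs_filter x)))) => -[f cf].
apply: (@continuous_comp_initial Y weak R^o f A) x => x.
have -> : f \o A = (fun x => f a + l * f x).
  by apply/funext => y; rewrite /= /A linearD linearZ.
have fx : f (y : weak) @[y --> (x : weak)] --> (f x : R^o).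
  exact: weak_continuous_linear.
exact: (cvgD (cvg_cst (f a : R^o)) (cvgM (cvg_cst (l : R^o)) fx)).
Qed.

End weak_topology.

(** * The defect of the triangle inequality on the real line *)

Definition defect {R : numDomainType} {V : normedZmodType R} (x y : V) : R :=
  `|x| + `|y| - `|x + y|.

Section defect_real.
Context {R : realType}.
Implicit Types (g x y : R).

Lemma defect_ge0 g x : 0 <= defect g x.
Proof. by rewrite /defect subr_ge0 ler_normD. Qed.

Lemma defect_le g x : defect g x <= 2 * `|g|.
Proof.
have := ler_normD (g + x) (- g); rewrite addrAC subrr add0r normrN /defect.
lra.
Qed.

(** If [x] and [y] have opposite signs, [g] agrees in sign with one of them and that defect
    vanishes. If they have the same sign, the right side is [2 min(|x|, |y|)], which bounds the
    defect of the smaller one. *)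
Lemma defect_dichotomy g x y :
  defect g x <= defect x (- y) \/ defect g y <= defect x (- y).
Proof.
rewrite /defect normrN.
case: (ger0P g); case: (ger0P x); case: (ger0P y);
  case: (ger0P (g + x)); case: (ger0P (g + y)); case: (ger0P (x - y)) => *;
  lra.
Qed.

Lemma sum_defect_le g (x : nat -> R) n :
  \sum_(j < n) defect g (x j) <=
  2 * `|g| + \sum_(k < n) \sum_(j < k) defect (x j) (- x k).
Proof.
(* The induction needs the sharper [m], the one defect not yet paid for. When [x n] arrives, either
   the new pair sum [P] covers [defect g (x n)], or by the dichotomy it covers [m], and
   [defect g (x n)] takes the place of [m]. *)
suff [m [mP mle]] : exists m,
    (m = 0 \/ exists2 j, (j < n)%N & m = defect g (x j)) /\
    \sum_(j < n) defect g (x j) <=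
       m + \sum_(k < n) \sum_(j < k) defect (x j) (- x k).
  apply: (le_trans mle); rewrite lerD2r.
  by case: mP => [->|[j _ ->]]; [rewrite mulr_ge0|exact: defect_le].
elim: n => [|n [m [mP mle]]].
  by exists 0; rewrite !big_ord0 addr0; split; [left|].
rewrite !big_ord_recr /=.
set P := \sum_(j < n) defect (x j) (- x n).
have P0 : 0 <= P by apply: sumr_ge0 => j _; exact: defect_ge0.
have [mge|mlt] := leP (defect g (x n)) P.
  exists m; split; last by lra.
  by case: mP => [|[j jn ->]]; [left|right; exists j => //; exact: ltnW].
exists (defect g (x n)); split; first by right; exists n.
suff : m <= P by lra.
case: mP => [-> //|[j jn ->]].
have jP : defect (x j) (- x n) <= P.
  rewrite /P (bigD1 (Ordinal jn)) //= lerDl.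
  by apply: sumr_ge0 => i _; exact: defect_ge0.
case: (defect_dichotomy g (x j) (x n)); lra.
Qed.

End defect_real.

(** * Integrating the defect inequality to L1 *)

Section L1_functionals.
Context {d} {T : measurableType d} {R : realType}.
Context {mu : {measure set T -> \bar R}}.
Implicit Types x y : L1 mu.

Lemma L1_measurable x : measurable_fun [set: T] (x : T -> R).
Proof. exact: (measurable_funPT (L1_repr x)). Qed.

Lemma L1_integrable x : mu.-integrable [set: T] (EFin \o (x : T -> R)).
Proof. by apply/Lfun1_integrable; exact: (LfunP (L1_repr x)). Qed.

Lemma L1_addE x y : ((x + y : L1 mu) : T -> R) = (fun t => x t + y t) %[ae mu].
Proof. exact: L1_class_ae. Qed.

Lemma L1_oppE x : ((- x : L1 mu) : T -> R) = (fun t => - x t) %[ae mu].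
Proof. exact: L1_class_ae. Qed.

Lemma L1_scaleE (a : R) x :
  ((a *: x : L1 mu) : T -> R) = (fun t => a * x t) %[ae mu].
Proof. exact: L1_class_ae. Qed.

Lemma L1_norm_Rintegral x : `|x| = \int[mu]_t `|x t|.
Proof. by rewrite /Rintegral -L1_norm_integral. Qed.

Lemma ae_eq_Rintegral (f g : T -> R) :
  measurable_fun [set: T] f -> measurable_fun [set: T] g ->
  f = g %[ae mu] -> \int[mu]_t f t = \int[mu]_t g t.
Proof.
move=> mf mg fg; congr fine; apply: ae_eq_integral => //.
- exact/measurable_EFinP.
- exact/measurable_EFinP.
- by apply: filterS fg => t fgt It /=; rewrite fgt.
Qed.

Lemma integrable_norm_addr (f g : T -> R) :
  mu.-integrable [set: T] (EFin \o f) -> mu.-integrable [set: T] (EFin \o g) ->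
  mu.-integrable [set: T] (EFin \o (fun t => `|f t + g t|)).
Proof.
by move=> fi gi; have := integrable_norm (integrableD measurableT fi gi).
Qed.

Lemma integrable_norm_L1 x :
  mu.-integrable [set: T] (EFin \o (fun t => `|x t|)).
Proof. by have := integrable_norm (L1_integrable x). Qed.

Lemma norm_add_Rintegral x y : `|x + y| = \int[mu]_t `|x t + y t|.
Proof.
rewrite L1_norm_Rintegral; apply: ae_eq_Rintegral.
- by apply: measurableT_comp => //; exact: L1_measurable.
- apply: measurableT_comp => //.
  by apply: measurable_funD; exact: L1_measurable.
- by apply: filterS (L1_addE x y) => t xy It; rewrite xy.
Qed.

Lemma integrable_defect (f g : T -> R) :
  mu.-integrable [set: T] (EFin \o f) -> mu.-integrable [set: T] (EFin \o g) ->
  mu.-integrable [set: T] (EFin \o (fun t => defect (f t) (g t))).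
Proof.
move=> fi gi.
have fg := integrableD measurableT (integrable_norm fi) (integrable_norm gi).
by have := integrableB measurableT fg (integrable_norm_addr fi gi).
Qed.

Lemma defect_Rintegral x y : defect x y = \int[mu]_t defect (x t) (y t).
Proof.
rewrite RintegralB//.
- rewrite RintegralD//; [|exact: integrable_norm_L1..].
  by rewrite -!L1_norm_Rintegral -norm_add_Rintegral.
- have := integrableD measurableT (integrable_norm_L1 x) (integrable_norm_L1 y).
  exact.
- by apply: integrable_norm_addr; exact: L1_integrable.
Qed.

Lemma integrable_opp_L1 x :
  mu.-integrable [set: T] (EFin \o (fun t => - x t)).
Proof. by have := integrableN (L1_integrable x). Qed.

(** The chosen representative of [- y] equals [- y t] only almost everywhere, whereas the pointwise
    inequality is about [- y t] itself. *)
Lemma defect_opp_Rintegral x y :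
  defect x (- y) = \int[mu]_t defect (x t) (- y t).
Proof.
rewrite defect_Rintegral; apply: ae_eq_Rintegral.
- apply/measurable_EFinP/measurable_int/integrable_defect.
  + exact: L1_integrable.
  + exact: L1_integrable.
- apply/measurable_EFinP/measurable_int/integrable_defect.
  + exact: L1_integrable.
  + exact: integrable_opp_L1.
- by apply: filterS (L1_oppE y) => t yt It; rewrite yt.
Qed.

Lemma integrable_sum_ord n (h : nat -> T -> R) :
  (forall j, mu.-integrable [set: T] (EFin \o h j)) ->
  mu.-integrable [set: T] (EFin \o (fun t => \sum_(j < n) h j t)).
Proof.
move=> hi; elim: n => [|n IHn].
  apply: eq_integrable (integrable0 mu [set: T]) => // t _ /=.
  by rewrite big_ord0.
apply: eq_integrable (integrableD measurableT IHn (hi n)) => // t _ /=.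
by rewrite big_ord_recr.
Qed.

Lemma Rintegral_sum_ord n (h : nat -> T -> R) :
  (forall j, mu.-integrable [set: T] (EFin \o h j)) ->
  \int[mu]_t (\sum_(j < n) h j t) = \sum_(j < n) \int[mu]_t h j t.
Proof.
move=> hi; elim: n => [|n IHn].
  rewrite big_ord0 -[RHS](mul0r (\int[mu]_t h 0 t)) -RintegralZl//.
  by apply: eq_Rintegral => t _; rewrite big_ord0 mul0r.
rewrite big_ord_recr /= -IHn -RintegralD//; last exact: integrable_sum_ord.
by apply: eq_Rintegral => t _; rewrite big_ord_recr.
Qed.

Lemma sum_defect_le_L1 (g : L1 mu) (x : nat -> L1 mu) n :
  \sum_(j < n) defect g (x j) <=
  2 * `|g| + \sum_(k < n) \sum_(j < k) defect (x j) (- x k).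
Proof.
have ig j : mu.-integrable [set: T] (EFin \o (fun t => defect (g t) (x j t))).
  by apply: integrable_defect; exact: L1_integrable.
have ix k j :
    mu.-integrable [set: T] (EFin \o (fun t => defect (x j t) (- x k t))).
  by apply: integrable_defect; [exact: L1_integrable|exact: integrable_opp_L1].
have ixs k : mu.-integrable [set: T]
    (EFin \o (fun t => \sum_(j < k) defect (x j t) (- x k t))).
  exact: (integrable_sum_ord k (ix k)).
have ig2 : mu.-integrable [set: T] (EFin \o (fun t => 2 * `|g t|)).
  by have := integrableZl measurableT 2 (integrable_norm_L1 g).
under eq_bigr do rewrite defect_Rintegral.
under [X in _ + X]eq_bigr => k _.
  under eq_bigr do rewrite defect_opp_Rintegral.
  rewrite -(Rintegral_sum_ord k (ix k)).
  over.
rewrite -(Rintegral_sum_ord n ig) -(Rintegral_sum_ord n ixs) L1_norm_Rintegral.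
rewrite -RintegralZl//; last exact: integrable_norm_L1.
rewrite -RintegralD//; last exact: (integrable_sum_ord n ixs).
apply: le_Rintegral => //.
- exact: (integrable_sum_ord n ig).
- by have := integrableD measurableT ig2 (integrable_sum_ord n ixs).
- by move=> t _; exact: (sum_defect_le (g t) (fun j => x j t) n).
Qed.

(** * Contractive functionals on L1 and weak lower semicontinuity of the norm *)

Section pairing.
Variable s : T -> R.
Hypotheses (ms : measurable_fun [set: T] s) (s1 : forall t, `|s t| <= 1).

(* The proof arguments make the linear structure below inferable. *)
Definition L1_pairing
  (_ : measurable_fun [set: T] s) (_ : forall t, `|s t| <= 1)
  (x : L1 mu) : R^o := \int[mu]_t (s t * x t).

Lemma integrable_pairing x :
  mu.-integrable [set: T] (EFin \o (fun t => s t * x t)).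
Proof.
apply: (le_integrable measurableT _ _ (L1_integrable x)).
  by apply/measurable_EFinP/measurable_funM => //; exact: L1_measurable.
by move=> t _ /=; rewrite lee_fin normrM ler_piMl.
Qed.

Lemma L1_pairing_linear : linear (L1_pairing ms s1).
Proof.
move=> a x y; rewrite /L1_pairing /= /GRing.scale /=.
have ax : mu.-integrable [set: T] (EFin \o (fun t => a * (s t * x t))).
  by have := integrableZl measurableT a (integrable_pairing x).
rewrite -RintegralZl//; last exact: integrable_pairing.
rewrite -RintegralD//; last exact: integrable_pairing.
apply: ae_eq_Rintegral.
- by apply: measurable_funM => //; exact: (L1_measurable (a *: x + y)).
- have := integrableD measurableT ax (integrable_pairing y).
  by move=> /measurable_int/measurable_EFinP.
- move: (L1_addE (a *: x) y) (L1_scaleE a x); apply: filterS2 => t e1 e2 It.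
  by rewrite e1// e2// mulrDr mulrCA.
Qed.

HB.instance Definition _ :=
  GRing.isLinear.Build R (L1 mu) R^o *:%R (L1_pairing ms s1)
    L1_pairing_linear.

Lemma L1_pairing_le x : `|L1_pairing ms s1 x| <= `|x|.
Proof.
apply: (le_trans (le_normr_Rintegral measurableT (integrable_pairing x))).
rewrite L1_norm_Rintegral; apply: le_Rintegral => //.
- by have := integrable_norm (integrable_pairing x).
- exact: integrable_norm_L1.
- by move=> t _; rewrite normrM ler_piMl.
Qed.

Lemma L1_pairing_continuous : continuous (L1_pairing ms s1).
Proof.
apply/linear_bounded_continuous/linear_boundedP; near=> M => x.
by rewrite (le_trans (L1_pairing_le x))// ler_peMl.
Unshelve. all: by end_near. Qed.

End pairing.

(* The norm is a supremum of contractive linear functionals: that of [a - y] is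
   attained at the integral against the sign of [a - y]. *)
Lemma weak_open_norm_gt (a : L1 mu) (r : R) :
  weak_open [set y : L1 mu | r < `|a - y|].
Proof.
rewrite [X in weak_open X](_ : _ =
    \bigcup_(f in [set f : {linear L1 mu -> R^o} | continuous f /\
      forall y, f y <= `|y|]) (f @^-1` [set z : R^o | z < f a - r])).
  apply: bigcup_open => f [cf _]; apply: weak_open_preimage_linear => //.
apply/seteqP; split=> [y /= ry|y [f [_ fle]]] /=; last first.
  by have := fle (a - y); rewrite linearB /=; lra.
pose s t : R := if 0 <= (a - y : L1 mu) t then 1 else -1.
have s1 t : `|s t| <= 1 by rewrite /s; case: ifP; rewrite ?normrN normr1.
have ms : measurable_fun [set: T] s.
  apply: measurable_fun_ifT => //.
  by apply: measurable_fun_ler => //; exact: L1_measurable.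
exists (L1_pairing ms s1).
  split; first exact: L1_pairing_continuous.
  by move=> z; exact: le_trans (ler_norm _) (L1_pairing_le ms s1 z).
suff sE : L1_pairing ms s1 (a - y) = `|a - y|.
  by move: sE; rewrite linearB /=; lra.
rewrite L1_norm_Rintegral; apply: eq_Rintegral => t _.
by rewrite /s; case: ger0P => _; rewrite ?mul1r ?mulN1r.
Qed.

End L1_functionals.

(** * Diameters in the unit ball and a Daugavet-type condition on sets *)

Section wHD2_sets.
Context {R : realType} {Y : completeNormedModType R}.
Implicit Types C W : set Y.

Lemma dist_unit_ball C x y :
  C `<=` @unit_ball R Y -> C x -> C y -> `|x - y| <= 2.
Proof.
move=> CB /CB Bx /CB By; apply: (le_trans (ler_normB _ _)).
by move: Bx By; rewrite /unit_ball /=; lra.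
Qed.

Lemma diam_ge C x y : C `<=` @unit_ball R Y -> C x -> C y -> `|x - y| <= diam C.
Proof.
move=> CB Cx Cy; apply: ub_le_sup; last by exists x => //; exists y.
by exists 2 => _ [u Cu [v Cv <-]]; exact: dist_unit_ball CB Cu Cv.
Qed.

Lemma diam_le2 C : C !=set0 -> C `<=` @unit_ball R Y -> diam C <= 2.
Proof.
move=> [x Cx] CB; apply: ge_sup.
  by exists `|x - x|; exists x => //; exists x.
by move=> _ [u Cu [v Cv <-]]; exact: dist_unit_ball CB Cu Cv.
Qed.

Lemma wHD2_far C W (e : R) : wHD2 C -> weak_open W -> C `&` W !=set0 -> 0 < e ->
  exists x y, [/\ (C `&` W) x, (C `&` W) y & 2 - e < `|x - y|].
Proof.
move=> [_ _ dC] oW CW e0.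
have : 2 - e < diam (C `&` W) by have := dC W oW CW; lra.
move=> /sup_gt[|_ [x xCW [y yCW <-]] exy]; last by exists x, y.
by case: CW => x xCW; exists `|x - x|; exists x => //; exists x.
Qed.

(** A Daugavet property localised to the weakly open pieces of one set: for [C] in the unit ball,
    some point of each piece almost attains equality in the triangle inequality with [g]. The series
    argument sees the sets only through this condition. *)
Definition weak_daugavet C := forall W (g : Y) (e : R), weak_open W ->
  C `&` W !=set0 -> 0 < e -> exists2 x, (C `&` W) x & `|g| + 1 - e <= `|g + x|.

(** By homogeneity, [l^-1 *: g] is used in place of [g]. Weights may vanish, and for [l = 0] any
    point serves. *)
Lemma weak_daugavetZ C W (g : Y) (l e : R) : weak_daugavet C -> weak_open W ->
  C `&` W !=set0 -> 0 < e -> 0 <= l ->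
  exists2 x, (C `&` W) x & `|g| + l * (1 - e) <= `|g + l *: x|.
Proof.
move=> dC oW CW e0; rewrite le_eqVlt => /predU1P[<-|l0].
  by case: CW => x xCW; exists x => //; rewrite mul0r scale0r !addr0.
have [x xCW gx] := dC W (l^-1 *: g) e oW CW e0; exists x => //.
have -> : g + l *: x = l *: (l^-1 *: g + x).
  by rewrite scalerDr scalerA divff ?gt_eqF// scale1r.
rewrite normrZ gtr0_norm//; apply: le_trans (ler_wpM2l (ltW l0) gx).
suff -> : `|g| = l * `|l^-1 *: g| by lra.
by rewrite normrZ gtr0_norm ?invr_gt0// mulrA divff ?mul1r// gt_eqF.
Qed.

(** * Convex series of sets satisfying the condition *)

Section series.
Variables (C : nat -> set Y) (lambda : R^nat).
Hypotheses (CB : forall i, C i `<=` @unit_ball R Y) (C0 : forall i, C i !=set0).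
Hypotheses (lambda_ge0 : forall i, 0 <= lambda i)
           (lambda1 : series lambda @ \oo --> (1 : R)).

Lemma series_weights_le1 n : series lambda n <= 1.
Proof.
rewrite -(cvg_lim (@Rhausdorff R) lambda1).
apply: nondecreasing_cvgn_le; last by apply/cvg_ex; exists 1.
by apply: nondecreasing_series.
Qed.

Lemma set_series_nonempty : set_series lambda C !=set0.
Proof.
have /choice[c Cc] i : exists x, C i x by have [x] := C0 i; exists x.
suff /cvg_ex[x cx] : cvgn (series (fun i => lambda i *: c i)) by exists x, c.
apply: normed_cvg; apply: (@series_le_cvg _ _ lambda) => //.
- by move=> n /=.
- move=> n /=; rewrite normrZ ger0_norm// ler_piMr//.
  exact: CB (Cc n).
- by apply/cvg_ex; exists 1.
Qed.

Lemma set_series_unit_ball : set_series lambda C `<=` @unit_ball R Y.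
Proof.
move=> x [c Cc cx]; rewrite /unit_ball /=.
rewrite -(cvg_lim (@norm_hausdorff _ _) (cvg_norm cx)).
apply: limr_le; first by apply/cvg_ex; exists `|x|; exact: cvg_norm.
apply: nearW => n; apply: le_trans (series_weights_le1 n).
apply: (le_trans (ler_norm_sum _ _ _)); apply: ler_sum => i _.
by rewrite normrZ ger0_norm// ler_piMr//; exact: CB (Cc i).
Qed.

Hypothesis dC : forall i, weak_daugavet (C i).

Lemma series_update (c : Y^nat) n (y : Y) z :
  series (fun i => lambda i *: c i) @ \oo --> z ->
  series (fun i => lambda i *: (if i == n then y else c i)) @ \oo -->
    z - lambda n *: c n + lambda n *: y.
Proof.
move=> cz.
have : series (fun i => lambda i *: c i) k +
    (lambda n *: y - lambda n *: c n) @[k --> \oo] -->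
    z + (lambda n *: y - lambda n *: c n).
  by apply: cvgD => //; exact: cvg_cst.
rewrite addrA addrAC; apply: cvg_trans; apply: near_eq_cvg.
(* Partial sums of length [k] contain the term [n] only for [n < k]; from there on the two series
   differ by a fixed vector. *)
exists n.+1 => // k /= nk.
have split_n (w : Y^nat) : series (fun i => lambda i *: w i) k =
    lambda n *: w n + \sum_(i < k | i != Ordinal nk) lambda i *: w i.
  by rewrite /series /= big_mkord (bigD1 (Ordinal nk)).
rewrite !split_n eqxx addrC addrA subrK; congr (_ + _).
by apply: eq_bigr => i /negbTE; rewrite -val_eqE /= => ->.
Qed.

Section replace.
Variables (W : set Y) (c : Y^nat) (z : Y) (e : R).
Hypotheses (oW : weak_open W) (e0 : 0 < e).
Hypotheses (Cc : forall i, C i (c i)) (Wz : W z).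
Hypothesis cz : series (fun i => lambda i *: c i) @ \oo --> z.

(** The points of [W] reachable by replacing only terms before [n]. As the tail is untouched, any
    two such points still share the term [c n]. *)
Definition tail_point n p := W p /\ exists u : Y^nat,
  [/\ forall i, C i (u i), forall i, (n <= i)%N -> u i = c i &
      series (fun i => lambda i *: u i) @ \oo --> p].

(** The vector [p' - p + lambda n *: c n] is [lambda n] times the new term, which is chosen in [C n]
    almost in line with [g]. *)
Lemma tail_point_step n p g : tail_point n p -> exists2 p', tail_point n.+1 p' &
  `|g| + lambda n * (1 - e) <= `|g + (p' - p + lambda n *: c n)|.
Proof.
move=> [Wp [u [Cu uc up]]].
(* The admissible new terms; [c n] is one of them, since it gives back [p]. *)
pose V := [set x | W (p - lambda n *: c n + lambda n *: x)].
have CV : C n `&` V !=set0 by exists (c n); split; rewrite ?/V /= ?subrK.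
have [x [Cx Vx] gx] := weak_daugavetZ g (@dC n)
  (weak_open_preimage_affine (p - lambda n *: c n) (lambda n) oW)
  CV e0 (lambda_ge0 n).
exists (p - lambda n *: c n + lambda n *: x); last first.
  apply: (le_trans gx); rewrite le_eqVlt; apply/orP; left; apply/eqP.
  congr (`|_ + _|).
  by rewrite [RHS]addrAC [X in X + _ - _]addrAC subrK [RHS]addrAC subrr add0r.
split=> //; exists (fun i => if i == n then x else u i); split.
- by move=> i; case: eqP => [->|_].
- move=> i ni; rewrite gtn_eqF//; exact/uc/ltnW.
- by rewrite -(uc n)//; exact: series_update.
Qed.

Lemma tail_points_far n : exists p q, [/\ tail_point n p, tail_point n q &
  2 * (1 - e) * series lambda n <= `|p - q|].
Proof.
elim: n => [|n [p [q [tp tq pq]]]].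
  have tz : tail_point 0 z by split=> //; exists c.
  by exists z, z; rewrite /series /= big_geq// mulr0 subrr normr0.
(* The vector [h] is [p' - q + lambda n *: c n]. Replacing in the other copy against [- h] cancels
   the shared term [lambda n *: c n] and leaves [q' - p']; the two replacements together gain
   [2 * lambda n * (1 - e)]. *)
have [p' tp' pp'] := tail_point_step (p - q) tp.
set h := p - q + _ in pp'.
have [q' tq' qq'] := tail_point_step (- h) tq.
exists p', q'; split=> //.
have -> : `|p' - q'| = `|- h + (q' - q + lambda n *: c n)|.
  rewrite -normrN opprB; congr (`|_|).
  have -> : h = p' + lambda n *: c n - q.
    by rewrite /h [p' - p + _]addrAC [LHS]addrC addrA subrK.
  rewrite [q' - q + _]addrAC [RHS]addrC opprB addrA subrK.
  by rewrite opprD addrACA subrr addr0.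
move: pq pp' qq'; rewrite seriesSr normrN; lra.
Qed.

End replace.

Lemma set_series_diam_ge2 W : weak_open W -> set_series lambda C `&` W !=set0 ->
  2 <= diam (set_series lambda C `&` W).
Proof.
move=> oW [z [[c Cc cz] Wz]].
have SB : set_series lambda C `&` W `<=` @unit_ball R Y.
  by move=> x [/set_series_unit_ball].
apply/ler_addgt0Pr => e e0.
have e20 : 0 < e / 2 by rewrite divr_gt0.
suff : 2 * (1 - e / 2) <= diam (set_series lambda C `&` W) by lra.
(* The distances reached after [n] replacements are bounded below by a sequence with limit [2 - e],
   because the weights sum to 1. *)
have cvgd : 2 * (1 - e / 2) * series lambda n @[n --> \oo] --> 2 * (1 - e / 2).
  by rewrite -[X in _ --> X]mulr1; apply: cvgM => //; exact: cvg_cst.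
rewrite -(cvg_lim (@Rhausdorff R) cvgd).
apply: limr_le; first by apply/cvg_ex; exists (2 * (1 - e / 2)).
apply: nearW => n.
have [p [q [[Wp [u [Cu _ up]]] [Wq [v [Cv _ vq]]] pq]]] :=
  tail_points_far oW e20 Cc Wz cz n.
by apply: (le_trans pq); apply: diam_ge => //; split=> //; [exists u|exists v].
Qed.

Lemma set_series_wHD2 : wHD2 (set_series lambda C).
Proof.
split.
- exact: set_series_nonempty.
- exact: set_series_unit_ball.
- exact: set_series_diam_ge2.
Qed.

End series.

Lemma wHD2_diam C : wHD2 C -> diam C = 2.
Proof.
move=> [C0 CB dC]; apply/eqP; rewrite eq_le diam_le2//=.
by have := dC _ weak_openT; rewrite setIT; apply.
Qed.

End wHD2_sets.

(** * The Daugavet-type condition for wHD2 subsets of L1 *)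

Section wHD2_L1.
Context {d} {T : measurableType d} {R : realType}.
Context {mu : {measure set T -> \bar R}}.
Implicit Types C W : set (L1 mu).

(** From a far pair [x], [y] the point [x] is kept, and the construction continues among the points
    far from [x]. They form a weakly open set, which [C] meets within [W] at [y]. *)
Lemma wHD2_separated C W (e : R) n : wHD2 C -> weak_open W ->
  C `&` W !=set0 -> 0 < e -> exists x : nat -> L1 mu,
    (forall j, (C `&` W) (x j)) /\
    (forall j k, (j < k < n)%N -> 2 - e < `|x j - x k|).
Proof.
move=> wC + + e0; elim: n W => [|n IHn] W oW CW.
  by case: CW => x xCW; exists (fun=> x); split=> // j k; rewrite ltn0 andbF.
have [x [y [xCW [Cy Wy] xy]]] := wHD2_far wC oW CW e0.
have [||u [CWu sep_u]] := IHn (W `&` [set z : L1 mu | 2 - e < `|x - z|]).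
- by apply: weak_openI => //; exact: weak_open_norm_gt.
- by exists y.
exists (fun j => if j is j'.+1 then u j' else x); split.
  by case=> // j; have [Cu [Wu _]] := CWu j.
case=> [|j] [|k] //=; last by rewrite !ltnS; exact: sep_u.
by move=> _; have [_ []] := CWu k.
Qed.

Lemma wHD2_weak_daugavet C : wHD2 C -> weak_daugavet C.
Proof.
move=> wC W g e oW CW e0.
have CB : C `<=` @unit_ball R (L1 mu) by case: wC.
(* Points of norm almost 1 are needed, so that a small defect makes the norm of the sum almost
   [|g| + 1]. Either point of a far pair is one, the other having norm at most 1. *)
pose V := W `&` [set x : L1 mu | 1 - e / 2 < `|0 - x|].
have oV : weak_open V by apply: weak_openI => //; exact: weak_open_norm_gt.
have CV : C `&` V !=set0.
  have [|x [y [[Cx Wx] [Cy Wy] xy]]] := wHD2_far wC oW CW (e := e / 2).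
    by lra.
  exists x; split=> //; split=> //=; rewrite sub0r normrN.
  by have := ler_normB x y; have := CB _ Cy; rewrite /unit_ball /=; lra.
(* If all defects exceeded [e / 2], the inequality would give [n * e / 2 <= 2 * |g| + n * e / 4],
   that is [n <= N]. *)
pose N := `|g| * 8 / e.
have N0 : 0 <= N by rewrite /N divr_ge0 ?mulr_ge0// ltW.
have [n nN] : exists n, N < n%:R by exists (Num.bound N); exact: archi_boundP.
have n0 : 0 < n%:R :> R by exact: le_lt_trans nN.
(* Each pair has defect at most [eta] and each [k] occurs with fewer than [n] indices [j], so the
   double sum is at most [n * (n * eta) = n * e / 4]. *)
pose eta := e / (4 * n%:R).
have eta0 : 0 < eta by rewrite divr_gt0// mulr_gt0.
have [x [CVx sep_x]] := wHD2_separated n wC oV CV eta0.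
have [[j small]|large] := pselect (exists j, defect g (x j) <= e / 2).
  have [Cx [Wx xj]] := CVx j; exists (x j) => //.
  by move: small xj; rewrite /defect /= sub0r normrN; lra.
have lower : n%:R * (e / 2) <= \sum_(j < n) defect g (x j).
  rewrite -[n in n%:R]card_ord -sum1_card natr_sum mulr_suml.
  apply: ler_sum => j _; rewrite mul1r leNgt; apply/negP => /ltW small.
  by apply: large; exists j.
have upper : \sum_(k < n) \sum_(j < k) defect (x j) (- x k) <= n%:R * (e / 4).
  have -> : n%:R * (e / 4) = \sum_(k < n) (n%:R * eta).
    rewrite sumr_const card_ord -[RHS]mulr_natl /eta; congr (_ * _).
    by field; rewrite gt_eqF.
  apply: ler_sum => k _.
  apply: (@le_trans _ _ (\sum_(j < k) eta)).
    apply: ler_sum => j _.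
    have jkn : (j < k < n)%N by rewrite !ltn_ord.
    have [Cj _] := CVx j; have [Ck _] := CVx k.
    have := sep_x _ _ jkn; have := CB _ Cj; have := CB _ Ck.
    by rewrite /unit_ball /defect /= normrN; lra.
  rewrite sumr_const card_ord -[leLHS]mulr_natl ler_wpM2r ?(ltW eta0)// ler_nat.
  exact/ltnW/ltn_ord.
have := sum_defect_le_L1 g x n.
by move: nN; rewrite /N ltr_pdivrMr//; lra.
Qed.

End wHD2_L1.

Theorem theorem1p2 (R : realType) (d : measure_display) (T : measurableType d)
    (mu : {measure set T -> \bar R}) (C : nat -> set (L1 mu)) (lambda : R^nat)
    (hC : forall i, wHD2 (C i))
    (lambda_ge0 : forall i, 0 <= lambda i)
    (lambda_sum1 : series lambda @ \oo --> (1 : R)) :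
  wHD2 (set_series lambda C) /\ diam (set_series lambda C) = 2.
Proof.
have wS : wHD2 (set_series lambda C).
  apply: set_series_wHD2 => // i.
  - by case: (hC i).
  - by case: (hC i).
  - exact: wHD2_weak_daugavet.
by split=> //; exact: wHD2_diam.
Qed.
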